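(* Let $\Omega\subset\mathbb{R}^n$ be a bounded domain as in the context and suppose $f:\Omega\to\mathbb{R}$ satisfies an $\alpha$-Hölder condition on $\Omega$: there are $C>0$ and $0<\alpha\le1$ with $|f(x')-f(x'')|<C\|x'-x''\|_2^\alpha$ for all distinct $x',x''\in\Omega$. Then for any $\epsilon>0$ there exist a quasi-uniform sample set $\chi\subset\Omega$ of size $N$ (with $N$ and $\gamma$ related to $h_{\Omega,\chi}$ as in the context) and a nearest-neighbor interpolant $\mathcal{I}_\chi f$ such that $$\Big|\min_{x\in\Omega}\mathcal{I}_\chi f(x)-f^*\Big|<\epsilon,$$ and the time complexity of $\mathcal{I}_\chi f$ is $$\mathcal{O}(N^a)=\mathcal{O}\Big(2^{\frac{na}{\alpha(1-\gamma)}\log_{\frac12}\epsilon}\Big),$$ where the time cost of computing $\mathcal{I}_\chi f$ on $N$ points is assumed to be $\mathcal{O}(N^a)$.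
   Context: Setting: $\Omega\subset\mathbb{R}^n$ is a (not necessarily convex) closed domain with $\max_{x,y\in\Omega}\|x-y\|_2\le 1$; $f^*=\min_{\Omega}f$. Samples: $\chi=\{\chi_i\}_{i=1}^N$ is quasi-uniform over $\Omega$, i.e. $\frac1\tau q_\chi\le h_{\Omega,\chi}\le\tau q_\chi$ for a uniformity constant $\tau>0$, where $h_{\Omega,\chi}=\sup_{x\in\Omega}\min_i\|x-\chi_i\|_2$ and $q_\chi=\frac12\min_{\chi_i\ne\chi_j}\|\chi_i-\chi_j\|_2$; its fill distance satisfies $h_{\Omega,\chi}=\mathcal{O}(N^{(\gamma-1)/n})$ where $0<\gamma\ll1$ is a fixed small number. A nearest-neighbor interpolant $\mathcal{I}_\chi f$ assigns to each $x\in\Omega$ the value $f(\chi_i)$ at a point $\chi_i\in\chi$ nearest to $x$ in the Euclidean norm. Asymptotics are as $\epsilon\to0$. *)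

(* Defs.v *)
From mathcomp Require Export all_boot all_order all_algebra finmap.
From mathcomp Require Export all_classical all_reals all_analysis.
Export numFieldNormedType.Exports.

Set Implicit Arguments.
Unset Strict Implicit.
Unset Printing Implicit Defensive.

Import Order.TTheory GRing.Theory Num.Theory.
Local Open Scope classical_set_scope.
Local Open Scope ring_scope.

Section Definitions.
Context {R : realType} {n : nat}.
Implicit Types (Omega : set 'rV[R]_n) (X : {fset 'rV[R]_n}).

(* The library norm of a row vector is the sup norm, not the Euclidean one; the
   product topology it induces is the usual one, so open, closure and
   connected below are the library's. *)
Definition norm2 (x : 'rV[R]_n) : R := Num.sqrt (\sum_(i < n) x 0 i ^+ 2).

(* A domain is a nonempty connected open set; a closed domain is the closure of
   one. *)
Definition closed_domain Omega :=
  exists U : set 'rV[R]_n,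
    [/\ open U, connected U, U !=set0 & Omega = closure U].

Definition is_min (A : set R) (m : R) := A m /\ lbound A m.

Definition dist_to X (x : 'rV[R]_n) : R :=
  inf [set norm2 (x - y) | y in [set` X]].

Definition fill_distance Omega X : R := sup [set dist_to X x | x in Omega].

Definition separation_radius X : R :=
  2^-1 * inf [set d | exists x y, [/\ x \in X, y \in X, x != y &
                                      d = norm2 (x - y)]].

(* With fewer than two points the minimum defining the separation radius is over
   the empty set, hence the first condition. *)
Definition quasi_uniform (tau : R) Omega X :=
  [/\ (1 < #|` X|)%N,
      tau^-1 * separation_radius X <= fill_distance Omega X &
      fill_distance Omega X <= tau * separation_radius X].

(* Ties between nearest sample points may be broken arbitrarily. *)
Definition nn_interpolant Omega X (f g : 'rV[R]_n -> R) :=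
  forall x, Omega x ->
    exists y, [/\ y \in X,
                  forall z, z \in X -> norm2 (x - y) <= norm2 (x - z) &
                  g x = f y].

Definition holder (alpha C : R) Omega (f : 'rV[R]_n -> R) :=
  forall x y, Omega x -> Omega y -> x != y ->
    `|f x - f y| < C * norm2 (x - y) `^ alpha.

End Definitions.

Definition logb {R : realType} (b x : R) : R := ln x / ln b.

(* Main.v *)
(* Sample [Omega] by an r-separated set of maximal cardinality, with r
   comparable to (eps / C)^(1/alpha). Maximality gives a fill distance at most r,
   so the Hoelder condition bounds the error by C r^alpha <= eps, while
   connectedness of [Omega] bounds the separation radius by the fill distance.
   A grid pigeonhole gives N <= (c / r)^n, from which both asymptotic bounds
   follow. N tends to infinity because [Omega] contains a segment. *)
Require Import Defs.
From mathcomp Require Import ring lra.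
Import Order.TTheory GRing.Theory Num.Theory.
Local Open Scope classical_set_scope.
Local Open Scope ring_scope.

Set Implicit Arguments.
Unset Strict Implicit.
Unset Printing Implicit Defensive.

(** * The Euclidean norm on row vectors *)

Section Norm2.
Context {R : realType} {n : nat}.
Implicit Types (x y z : 'rV[R]_n).

Lemma norm2_ge0 x : 0 <= norm2 x.
Proof. exact: sqrtr_ge0. Qed.

Lemma norm2_sqr x : norm2 x ^+ 2 = \sum_(i < n) x 0 i ^+ 2.
Proof. by rewrite sqr_sqrtr // sumr_ge0 // => i _; rewrite sqr_ge0. Qed.

Lemma norm2B x y : norm2 (x - y) = norm2 (y - x).
Proof. by congr Num.sqrt; apply: eq_bigr => i _; rewrite !mxE -sqrrN opprB. Qed.

Lemma norm2_coord x i : `|x 0 i| <= norm2 x.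
Proof.
rewrite -sqrtr_sqr ler_wsqrtr // (bigD1 i) //= lerDl.
by rewrite sumr_ge0 // => j _; rewrite sqr_ge0.
Qed.

Lemma norm20 : norm2 (0 : 'rV[R]_n) = 0.
Proof.
by rewrite /norm2 big1 ?sqrtr0 // => i _; rewrite mxE expr0n.
Qed.

Lemma norm2_le0 x y : norm2 (x - y) <= 0 -> x = y.
Proof.
move=> xy; apply/rowP => i; apply/eqP; rewrite -subr_eq0 -normr_le0.
by have := norm2_coord (x - y) i; rewrite !mxE => /le_trans; apply.
Qed.

(** The factor [n], cruder than its square root, comes from $n \le n^2$; it is sharp enough for the
    grid argument. *)
Lemma norm2_le_coord x (e : R) :
  0 <= e -> (forall i, `|x 0 i| <= e) -> norm2 x <= n%:R * e.
Proof.
move=> e0 xe; rewrite -[leRHS]ger0_norm ?mulr_ge0// -sqrtr_sqr ler_wsqrtr //.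
have /le_trans : \sum_(i < n) x 0 i ^+ 2 <= \sum_(i < n) e ^+ 2.
  by apply: ler_sum => i _; rewrite -ler_sqrt ?sqr_ge0// !sqrtr_sqr (ger0_norm e0).
apply; rewrite sumr_const card_ord -[_ *+ n]mulr_natl exprMn ler_wpM2r ?sqr_ge0//.
by rewrite -natrX ler_nat; case: (n) => // m; rewrite leq_pmulr.
Qed.

(* Parallelogram law; used at equal radii it replaces the triangle inequality. *)
Lemma norm2_lt_double x y z (s : R) :
  norm2 (x - y) < s -> norm2 (x - z) <= s -> norm2 (y - z) < 2 * s.
Proof.
move=> xy xz; have s0 : 0 < s by apply: le_lt_trans xy; exact: norm2_ge0.
rewrite -ltr_sqr ?nnegrE ?norm2_ge0//; last by rewrite mulr_ge0 // ltW.
have : norm2 (y - z) ^+ 2 <= 2 * norm2 (x - y) ^+ 2 + 2 * norm2 (x - z) ^+ 2.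
  rewrite !norm2_sqr !mulr_sumr -big_split ler_sum //= => i _.
  rewrite !mxE; have := sqr_ge0 ((x 0 i - y 0 i) + (x 0 i - z 0 i)); nra.
have : norm2 (x - y) ^+ 2 < s ^+ 2 by rewrite ltr_sqr ?nnegrE ?norm2_ge0 ?(ltW s0).
have : norm2 (x - z) ^+ 2 <= s ^+ 2 by rewrite ler_sqr ?nnegrE ?norm2_ge0 ?(ltW s0).
rewrite exprMn; lra.
Qed.

Lemma norm2_continuous y : continuous (fun x => norm2 (x - y)).
Proof.
have sum_cont : continuous (fun x => \sum_(i < n) (x - y) 0 i ^+ 2).
  apply: continuous_big => [|i _ x]; first exact: add_continuous.
  have coord_cont : continuous (fun x => (x - y) 0 i).
    have -> : (fun x => (x - y) 0 i) = (fun x => x 0 i - y 0 i).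
      by apply/funext => u; rewrite !mxE.
    by move=> u; apply: (@cvgB _ _ _ (nbhs u) (nbhs_filter u)); [exact: coord_continuous|exact: cvg_cst].
  exact: (continuous_comp (coord_cont x) (@exprn_continuous _ 2 _)).
by move=> x; exact: (continuous_comp (sum_cont x) (@sqrt_continuous _ _)).
Qed.

End Norm2.

(** * Separated sets: cardinality bounds and covering *)

Section Packing.
Context {R : realType} {n : nat}.
Implicit Types (Omega : set 'rV[R]_n) (X Y : {fset 'rV[R]_n}) (r : R).

Definition packing r Omega X :=
  [set` X] `<=` Omega /\
  forall x y, x \in X -> y \in X -> x != y -> r <= norm2 (x - y).

(** Maximality in cardinality, stronger than maximality for inclusion, also bounds the size of [X]
    from below by that of any explicit packing. *)
Definition max_packing r Omega X :=
  packing r Omega X /\ forall Y, packing r Omega Y -> (#|` Y| <= #|` X|)%N.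

Lemma packing_le r s Omega X : r <= s -> packing s Omega X -> packing r Omega X.
Proof. by move=> rs [XO Xs]; split => // x y xX yX xy; exact: le_trans (Xs _ _ xX yX xy). Qed.

(* Two points in the same cell of a grid of mesh [1/K < r/n] are closer than [r]. *)
Lemma packing_card r Omega X : 0 < r <= 1 ->
  (forall x y, Omega x -> Omega y -> norm2 (x - y) <= 1) ->
  packing r Omega X -> #|` X|%:R <= ((2 * n%:R + 3) / r) ^+ n.
Proof.
move=> /andP[r0 r1] hdiam [XO Xr].
have [->|[p pX]] := fset_0Vmem X.
  by rewrite cardfs0 exprn_ge0// divr_ge0 ?(ltW r0)// addr_ge0// mulr_ge0.
set K := (Num.trunc (n%:R / r)).+1.
have K0 : 0 < K%:R :> R by rewrite ltr0n.
have nK : n%:R / K%:R < r by rewrite ltr_pdivrMr// mulrC -ltr_pdivrMr// truncnS_gt.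
(* Since the diameter is at most 1, coordinates relative to [p] lie in $[-1,1]$. Shifted by 1 and
   scaled by [K], they have at most $2K+1$ integer parts. *)
have coord x : x \in X -> forall i, 0 <= (x 0 i - p 0 i + 1) * K%:R <= (2 * K)%:R.
  move=> xX i; have := le_trans (norm2_coord (x - p) i) (hdiam _ _ (XO _ xX) (XO _ pX)).
  rewrite !mxE ler_norml natrM => /andP[h1 h2].
  by rewrite (pmulr_lge0 _ K0) (ler_pM2r K0); apply/andP; split; lra.
pose cell (x : X) : {ffun 'I_n -> 'I_(2 * K).+1} :=
  [ffun i => inord (Num.trunc ((val x 0 i - p 0 i + 1) * K%:R))].
have cell_inj : injective cell.
  move=> x y /ffunP xy; apply/val_inj/eqP; apply/contraT => neq.
  have := Xr _ _ (valP x) (valP y) neq; rewrite leNgt => /negP; case.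
  apply: le_lt_trans nK; apply: norm2_le_coord; first by rewrite invr_ge0 ltW.
  move=> i; have := xy i; rewrite !ffunE => /(congr1 val).
  have /andP[x0 x1] := coord _ (valP x) i; have /andP[y0 y1] := coord _ (valP y) i.
  rewrite /= !inordK ?ltnS ?truncn_le_nat; last 2 first.
  - by apply: le_lt_trans y1 _; rewrite ltr_nat.
  - by apply: le_lt_trans x1 _; rewrite ltr_nat.
  move=> e; have := truncn_itv x0; have := truncn_itv y0; rewrite e !mxE.
  move=> /andP[a1 +] /andP[b1 +]; rewrite -natr1 => a2 b2; rewrite -[leRHS]mul1r ler_pdivlMr//.
  rewrite -[X in _ * X](gtr0_norm K0) -normrM.
  by rewrite ler_norml; lra.
have := leq_card cell cell_inj; rewrite card_ffun !card_ord -cardfE => cX.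
apply: (@le_trans _ _ ((2 * K).+1 ^ n)%:R); first by rewrite ler_nat.
rewrite natrX; apply: lerXn2r; rewrite ?nnegrE ?ler0n//.
  by rewrite divr_ge0 ?(ltW r0)// addr_ge0// mulr_ge0.
(* $K \le n/r + 1$ gives $2K+1 \le 2n/r + 3$, and $r \le 1$ turns the 3 into $3/r$. *)
have : (Num.trunc (n%:R / r))%:R <= n%:R / r by rewrite truncn_le divr_ge0// ltW.
have : 1 <= r^-1 by rewrite invf_ge1.
rewrite -natr1 natrM /K -natr1 mulrDl; lra.
Qed.

(** The cardinalities of packings include 0 and are bounded by [packing_card], so a largest one is
    attained. *)
Lemma max_packing_exists r Omega : 0 < r <= 1 ->
  (forall x y, Omega x -> Omega y -> norm2 (x - y) <= 1) ->
  exists X, max_packing r Omega X.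
Proof.
move=> hr hdiam.
pose P k := `[< exists2 X, packing r Omega X & #|` X| = k >].
have exP : exists k, P k.
  by exists 0%N; apply/asboolP; exists fset0; [split => // x|exact: cardfs0].
have ubP k : P k -> (k <= Num.trunc (((2 * n%:R + 3) / r) ^+ n))%N.
  move=> /asboolP[X Xp <-]; have le := packing_card hr hdiam Xp.
  by rewrite truncn_ge_nat//; apply: le_trans le.
case: (ex_maxnP exP ubP) => k /asboolP[X Xp Xk] kmax.
by exists X; split => // Y Yp; rewrite Xk kmax//; apply/asboolP; exists Y.
Qed.

(** The open set contains a ball, and [M] points on a diagonal segment from its centre can be spaced
    proportionally to $1/M$. Comparison with this packing forces maximal packings to grow as the
    separation shrinks. *)
Lemma packing_line Omega : (0 < n)%N -> closed_domain Omega ->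
  exists2 e : R, 0 < e & forall M, (0 < M)%N ->
    exists2 X, packing (e / M%:R) Omega X & #|` X| = M.
Proof.
move=> n0 [U [oU _ [p Up] ->]].
have /nbhs_ballP[e /= e0 eU] := open_nbhs_nbhs (conj oU Up).
exists (e / 2); first by rewrite divr_gt0.
move=> M M0; have M0' : 0 < M%:R :> R by rewrite ltr0n.
pose g (k : 'I_M) : 'rV[R]_n := \row_i (p 0 i + k%:R * (e / 2 / M%:R)).
have d0 : 0 < e / 2 / M%:R by rewrite !divr_gt0.
have gd (j k : 'I_M) : j != k -> e / 2 / M%:R <= norm2 (g j - g k).
  move=> jk; apply: le_trans (norm2_coord _ (Ordinal n0)).
  rewrite !mxE opprD addrACA subrr add0r -mulrBl normrM (gtr0_norm d0).
  rewrite ler_peMl ?(ltW d0)// ler_normr.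
  move: jk; rewrite -val_eqE neq_ltn -!(ler_nat R) -!natr1 /=.
  by case/orP => jk; apply/orP; [right|left]; lra.
have ginj : injective g.
  move=> j k gjk; apply/eqP; apply/contraT => /gd.
  by rewrite gjk subrr norm20 leNgt d0.
exists [fset g k | k : 'I_M]%fset; last by rewrite card_imfset//= -cardE card_ord.
split=> [_ /imfsetP[k _ ->]|_ _ /imfsetP[j _ ->] /imfsetP[k _ ->] jk].
  apply/subset_closure/eU; split => // i j; rewrite /ball/= !mxE ord1.
  rewrite opprD addrA subrr sub0r normrN ger0_norm ?pmulr_lge0//.
  have : k%:R * (e / 2 / M%:R) <= M%:R * (e / 2 / M%:R).
    by rewrite ler_pM2r// ler_nat ltnW.
  by rewrite [M%:R * _]mulrC divfK ?gt_eqF//; move: e0; lra.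
by apply: gd; apply: contra_neq jk => ->.
Qed.

(** A point at distance at least [r] from all of [X] could be added to [X], contradicting
    maximality. *)
Lemma max_packing_cover r Omega X x : 0 < r -> max_packing r Omega X -> Omega x ->
  exists2 y, y \in X & norm2 (x - y) < r.
Proof.
move=> r0 [[XO Xr] Xmax] Ox; apply: contrapT => far.
have {}far y : y \in X -> r <= norm2 (x - y).
  by move=> yX; rewrite leNgt; apply/negP => ?; apply: far; exists y.
have xX : x \notin X.
  by apply/negP => /far; rewrite subrr norm20 leNgt r0.
suff /Xmax : packing r Omega (x |` X)%fset by rewrite cardfsU1 xX ltnn.
split=> [y|y z].
  by rewrite /= !inE => /orP[/eqP->//|/XO].
rewrite !inE => /orP[/eqP->|yX] /orP[/eqP->|zX]; rewrite ?eqxx// => yz.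
- exact: far.
- by rewrite norm2B; exact: far.
- exact: Xr.
Qed.

End Packing.

(** * Quasi-uniformity of maximal separated sets *)

Section QuasiUniform.
Context {R : realType} {n : nat}.
Implicit Types (Omega : set 'rV[R]_n) (X : {fset 'rV[R]_n}) (r s : R).

(* Otherwise the balls of radius [s] around the sample points would be a
   disjoint open cover of [Omega]. *)
Lemma connected_far_point Omega X s x0 y0 : connected Omega ->
  [set` X] `<=` Omega -> x0 \in X -> y0 \in X -> x0 != y0 ->
  (forall x y, x \in X -> y \in X -> x != y -> 2 * s <= norm2 (x - y)) ->
  exists2 x, Omega x & forall y, y \in X -> s <= norm2 (x - y).
Proof.
move=> cO XO x0X y0X x0y0 sep; apply: contrapT => cover.
have {}cover x : Omega x -> exists2 y, y \in X & norm2 (x - y) < s.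
  move=> Ox; apply: contrapT => far; apply: cover; exists x => // y yX.
  by rewrite leNgt; apply/negP => ?; apply: far; exists y.
have s0 : 0 < s.
  by have [y _] := cover _ (XO _ x0X); apply: le_lt_trans; exact: norm2_ge0.
have cont := @norm2_continuous R n x0.
pose B := Omega `&` [set x | norm2 (x - x0) < s].
have BO : B = Omega.
  apply: cO; first by exists x0; split; [exact: XO|rewrite /= subrr norm20].
  - exists [set x | norm2 (x - x0) < s] => //.
    exact: (open_comp (fun x _ => cont x) (@open_lt R s)).
  (* The open and closed balls have the same trace on [Omega]: a point at distance at most [s] from
     [x0] and less than [s] from another sample would put two samples closer than [2 * s]. *)
  - exists [set x | norm2 (x - x0) <= s].
      exact: (closed_comp (fun x _ => cont x) (@closed_le R s)).
    apply/seteqP; split => x [Ox]/= xs; split => //; first exact: ltW.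
    have [y yX xy] := cover _ Ox.
    have [<-//|yx0] := eqVneq y x0.
    by have := sep _ _ yX x0X yx0; rewrite leNgt (norm2_lt_double xy xs).
have : B y0 by rewrite BO; exact: XO.
move=> [_ /=]; have := sep _ _ y0X x0X; rewrite eq_sym x0y0 => /(_ isT).
lra.
Qed.

Lemma max_packing_fill_distance r Omega X : 0 < r -> Omega !=set0 ->
  max_packing r Omega X -> fill_distance Omega X <= r.
Proof.
move=> r0 [p Op] Xmax; apply: ge_sup; first by exists (dist_to X p), p.
move=> _ [x Ox <-]; have [y yX xy] := max_packing_cover r0 Xmax Ox.
apply: le_trans (ltW xy); apply: ge_inf; last by exists y.
by exists 0 => _ [z _ <-]; exact: norm2_ge0.
Qed.

Lemma fill_distance_ge0 Omega X : X != fset0 -> 0 <= fill_distance Omega X.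
Proof.
case/fset0Pn => y yX; rewrite /fill_distance; set S := (X in sup X).
(* When the supremum does not exist, [sup] takes the default value 0. *)
have [supS|nsupS] := pselect (has_sup S); last by rewrite sup_out.
have [[_ [x Ox _]] ubS] := supS.
apply: le_trans (ub_le_sup ubS _); last by exists x.
apply: lb_le_inf; first by exists (norm2 (x - y)), y.
by move=> _ [z _ <-]; exact: norm2_ge0.
Qed.

(** With $q$ the separation radius and $h$ the fill distance, covering and separation give $h \le r
    \le 2q$, while [connected_far_point] yields a point at distance at least $q$ from every sample,
    so $q/2 \le q \le h$. *)
Lemma max_packing_quasi_uniform r Omega X : 0 < r -> connected Omega ->
  max_packing r Omega X -> (1 < #|` X|)%N -> quasi_uniform 2 Omega X.
Proof.
move=> r0 cO Xmax X1; have [[XO Xr] _] := Xmax.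
have [x0 [y0 [x0X y0X x0y0]]] : exists x0 y0, [/\ x0 \in X, y0 \in X & x0 != y0].
  have [X0|[x xX]] := fset_0Vmem X; first by rewrite X0 cardfs0 in X1.
  have [X0|[y]] := fset_0Vmem (X `\ x)%fset.
    by have := cardfsD1 x X; rewrite X0 cardfs0 xX; move: X1 => /[swap] ->.
  by rewrite !inE => /andP[yx yX]; exists y, x.
rewrite /quasi_uniform /separation_radius; set S := (X in inf X).
have S0 : S !=set0 by exists (norm2 (x0 - y0)), x0, y0.
have lbS : has_lbound S by exists 0 => _ [x [y [_ _ _ ->]]]; exact: norm2_ge0.
have rS : r <= inf S by apply: lb_le_inf => // _ [x [y [xX yX xy ->]]]; exact: Xr.
have Sle x y : x \in X -> y \in X -> x != y -> inf S <= norm2 (x - y).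
  by move=> xX yX xy; apply: ge_inf => //; exists x, y.
have fill : fill_distance Omega X <= r.
  by apply: max_packing_fill_distance => //; exists x0; exact: XO.
split => //; last by rewrite mulrA divff// mul1r (le_trans fill).
have [|x Ox xfar] := connected_far_point (s := 2^-1 * inf S) cO XO x0X y0X x0y0.
  by move=> x y xX yX xy; rewrite mulrA divff// mul1r; exact: Sle.
apply: (@le_trans _ _ (dist_to X x)).
  apply: (@le_trans _ _ (2^-1 * inf S)); first by lra.
  apply: lb_le_inf; first by exists (norm2 (x - x0)), x0.
  by move=> _ [y yX <-]; exact: xfar.
apply: ub_le_sup; last by exists x.
exists r => _ [z Oz <-]; have [y yX zy] := max_packing_cover r0 Xmax Oz.
apply: le_trans (ltW zy); apply: ge_inf; last by exists y.
by exists 0 => _ [w _ <-]; exact: norm2_ge0.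
Qed.

End QuasiUniform.

(** * Nearest-neighbor interpolants and minima *)

Section Interpolation.
Context {R : realType} {n : nat}.
Implicit Types (Omega : set 'rV[R]_n) (X : {fset 'rV[R]_n}) (f g : 'rV[R]_n -> R).

Lemma nn_interpolant_exists Omega X f x0 : x0 \in X ->
  exists g, nn_interpolant Omega X f g.
Proof.
move=> x0X; suff /choice[g gP] : forall x, exists v, exists y,
    [/\ y \in X, forall z, z \in X -> norm2 (x - y) <= norm2 (x - z) & v = f y].
  by exists g => x _; exact: gP.
move=> x; pose F (y : X) : R := norm2 (x - val y).
have [y _ ymin] := @arg_minP _ _ _ [` x0X]%fset xpredT F isT.
exists (f (val y)), (val y); split => //; first exact: valP.
by move=> z zX; have := ymin [` zX]%fset isT.
Qed.

Lemma nn_interpolant_sample Omega X f g x : [set` X] `<=` Omega ->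
  nn_interpolant Omega X f g -> x \in X -> g x = f x.
Proof.
move=> XO gP xX; have [y [_ /(_ _ xX) + ->]] := gP _ (XO _ xX).
by rewrite subrr norm20 => /norm2_le0 ->.
Qed.

Lemma fset_argmin X f x0 : x0 \in X ->
  exists2 y, y \in X & forall z, z \in X -> f y <= f z.
Proof.
move=> x0X; pose F (y : X) : R := f (val y).
have [y _ ymin] := @arg_minP _ _ _ [` x0X]%fset xpredT F isT.
by exists (val y) => [|z zX]; [exact: valP|exact: (ymin [` zX]%fset isT)].
Qed.

(** The interpolant takes only sample values and reproduces them on [X], so its minimum is that of
    [f] over [X]. This is at least [fstar], and at most the value at a sample within [r] of a
    minimizer of [f]. *)
Lemma nn_interpolant_min Omega X f g (C alpha r : R) fstar :
  0 < C -> 0 <= alpha -> 0 < r ->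
  holder alpha C Omega f -> is_min [set f x | x in Omega] fstar ->
  max_packing r Omega X -> nn_interpolant Omega X f g ->
  exists m, is_min [set g x | x in Omega] m /\ `|m - fstar| < C * r `^ alpha.
Proof.
move=> C0 a0 r0 hf [[xs Oxs xsE] fmin] Xmax gP.
have [[XO _] _] := Xmax.
have [y yX xsy] := max_packing_cover r0 Xmax Oxs.
have [w wX wmin] := fset_argmin f yX.
exists (f w); split.
  split; first by exists w; [exact: XO|exact: nn_interpolant_sample XO gP wX].
  by move=> _ [x Ox <-]; have [z [zX _ ->]] := gP _ Ox; exact: wmin.
have fw : fstar <= f w by apply: fmin; exists w => //; exact: XO.
rewrite ger0_norm ?subr_ge0// ltrBlDr; apply: le_lt_trans (wmin _ yX) _.
(* The Hölder condition concerns distinct points only; if the minimizer is itself a sample,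
   strictness comes from the positivity of the bound. *)
have [<-|xy] := eqVneq xs y; first by rewrite xsE ltrDr mulr_gt0// powR_gt0.
have := hf _ _ Oxs (XO _ yX) xy; rewrite xsE distrC => /(le_lt_trans (ler_norm _)).
have : C * norm2 (xs - y) `^ alpha <= C * r `^ alpha.
  by rewrite ler_pM2l// ge0_ler_powR// ?nnegrE ?norm2_ge0 ?ltW.
lra.
Qed.

(** This identifies the radius at which the Hölder bound equals [e]. *)
Lemma powR_root_scaled (C alpha e : R) : 0 < C -> 0 < alpha -> 0 < e ->
  C * ((e / C) `^ alpha^-1) `^ alpha = e.
Proof.
move=> C0 a0 e0; rewrite -powRrM mulVf ?gt_eqF// powRr1 ?divr_ge0 ?ltW//.
by rewrite mulrC divfK ?gt_eqF.
Qed.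

(** [Omega] is closed and bounded, hence compact, and the Hölder condition makes [f] continuous on
    it. *)
Lemma holder_min Omega f (C alpha : R) : 0 < C -> 0 < alpha ->
  closed_domain Omega ->
  (forall x y, Omega x -> Omega y -> norm2 (x - y) <= 1) ->
  holder alpha C Omega f ->
  exists fstar, is_min [set f x | x in Omega] fstar.
Proof.
move=> C0 a0 [U [_ _ [p Up] OE]] hdiam hf.
have Op : Omega p by rewrite OE; exact: subset_closure.
have cO : compact Omega.
  apply: bounded_closed_compact; last by rewrite OE; exact: closed_closure.
  exists (`|p| + 1); split => // M Mlt x Ox.
  apply: le_trans (ltW Mlt); rewrite -[x](subrK p) addrC; apply: le_trans (ler_normD _ _) _.
  rewrite lerD2l [leLHS]mx_normrE; apply: bigmax_le => // -[i j] _ /=.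
  by rewrite ord1; apply: le_trans (norm2_coord _ _) (hdiam _ _ Ox Op).
have cf : {within Omega, continuous f}.
  apply/subspace_continuousP => x Ox; apply/cvgrPdist_le => e e0.
  set s := (e / C) `^ alpha^-1.
  have s0 : 0 < s by rewrite powR_gt0// divr_gt0.
  near=> y.
  have Oy : Omega y by near: y; exact: withinT.
  have [->|xy] := eqVneq x y; first by rewrite subrr normr0 ltW.
  apply/ltW/(lt_le_trans (hf _ _ Ox Oy xy)).
  rewrite -[leRHS](powR_root_scaled C0 a0 e0) ler_pM2l//.
  rewrite ge0_ler_powR// ?nnegrE ?norm2_ge0 ?ltW//.
  rewrite norm2B; near: y; apply: cvg_within.
  have := @norm2_continuous R n x x; rewrite /continuous_at subrr norm20.
  by move=> /cvgrPdist_lt/(_ _ s0); apply: filterS => y; rewrite sub0r normrN ger0_norm ?norm2_ge0.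
have [c] := compact_EVT_min (ex_intro _ p Op) cO cf; rewrite inE => Oc cmin.
exists (f c); split; first by exists c.
by move=> _ [x Ox <-]; apply: cmin; rewrite inE.
Unshelve. all: by end_near. Qed.

End Interpolation.

(** * Power estimates for the sample size *)

Section Rates.
Context {R : realType}.
Implicit Types (c r a b e C alpha gamma : R).

(** The logarithm to base 1/2 is minus the one to base 2, so the stated cost is a negative power of
    [e]. *)
Lemma powR2_logb2V b e : 0 < e -> 2 `^ (b * logb 2^-1 e) = e `^ (- b).
Proof.
move=> e0; rewrite /powR gt_eqF// gt_eqF// /logb lnV ?posrE//.
have : ln (2 : R) != 0 by rewrite gt_eqF// ln_gt0// ltr1n.
by move=> ln2; congr expR; field.
Qed.

(** Taking [n]-th roots gives $r \le c N^{-1/n}$; as $N \ge 1$, the exponent may be raised to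
    $(\gamma-1)/n$. *)
Lemma packing_fill_rate (n N : nat) c r gamma : (0 < n)%N -> (0 < N)%N -> 0 < r -> 0 < c ->
  0 < gamma -> N%:R <= (c / r) ^+ n -> r <= c * N%:R `^ ((gamma - 1) / n%:R).
Proof.
move=> n0 N0 r0 c0 g0 Nle; have n0' : 0 < n%:R :> R by rewrite ltr0n.
rewrite mulrC powRrM -powRrM [_ / _]mulrC powRrM.
have cr : 0 < c / r by rewrite divr_gt0.
have Nroot : N%:R `^ n%:R^-1 <= c / r.
  have -> : c / r = ((c / r) ^+ n) `^ n%:R^-1.
    by rewrite -powR_mulrn ?ltW// -powRrM divff ?gt_eqF// powRr1 ?ltW.
  by rewrite ge0_ler_powR ?nnegrE ?invr_ge0 ?ler0n ?exprn_ge0// ltW.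
have Nroot0 : 0 < (N%:R : R) `^ n%:R^-1 by rewrite powR_gt0// ltr0n.
have Nroot1 : 1 <= (N%:R : R) `^ n%:R^-1.
  by rewrite -[leLHS](powRr0 N%:R) ler_powR ?ler1n ?invr_ge0 ?ltW.
rewrite -ler_pdivrMr//; apply: (@le_trans _ _ ((N%:R `^ n%:R^-1) `^ (-1))).
  by rewrite powRN powRr1 ?(ltW Nroot0)// -[r / c]invf_div lef_pV2// ?posrE//.
by rewrite ler_powR//; lra.
Qed.

Lemma packing_cost_rate (n N : nat) c r a e C alpha gamma :
  0 <= c -> 0 < C -> 0 < alpha -> 0 < e <= 1 -> 0 <= a -> 0 < gamma < 1 ->
  r = (e / C) `^ alpha^-1 -> N%:R <= (c / r) ^+ n ->
  N%:R `^ a <= (c `^ (n%:R * a) * C^-1 `^ (- (n%:R * a / alpha)))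
    * e `^ (- (n%:R * a / (alpha * (1 - gamma)))).
Proof.
move=> c0 C0 al0 /andP[e0 e1] a0 /andP[g0 g1] rE Nle.
have r0 : 0 < r by rewrite rE powR_gt0// divr_gt0.
have cr : 0 <= c / r by rewrite divr_ge0// ltW.
apply: (@le_trans _ _ (((c / r) ^+ n) `^ a)).
  by rewrite ge0_ler_powR// nnegrE ?exprn_ge0.
rewrite -powR_mulrn// -powRrM powRM ?invr_ge0 ?(ltW r0)//.
rewrite -[leRHS]mulrA; refine (ler_wpM2l (powR_ge0 _ _) _).
rewrite rE -powRN -powRrM mulNr [alpha^-1 * _]mulrC powRM ?(ltW e0) ?invr_ge0 ?(ltW C0)//.
rewrite [leLHS]mulrC; refine (ler_wpM2l (powR_ge0 _ _) _).
(* For $e \le 1$, lowering the exponent raises the power; the factor $1/(1-\gamma) \ge 1$ does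
   so. *)
apply: ger_powR; first by rewrite e0.
rewrite lerN2 invfM mulrA ler_peMr ?divr_ge0 ?mulr_ge0 ?(ltW al0)//.
rewrite invf_ge1 ?subr_gt0//; lra.
Qed.

End Rates.

(* time X g : time cost of computing the interpolant g from the sample set X. *)
Theorem theorem6 (R : realType) (n : nat) (hn : (0 < n)%N)
    (Omega : set 'rV[R]_n) (hOmega : closed_domain Omega)
    (hdiam : forall x y, Omega x -> Omega y -> norm2 (x - y) <= 1)
    (gamma : R) (hgamma : 0 < gamma < 1)
    (f : 'rV[R]_n -> R) (C alpha : R) (hC : 0 < C) (halpha : 0 < alpha <= 1)
    (hf : holder alpha C Omega f)
    (a : R) (ha : 0 <= a)
    (time : {fset 'rV[R]_n} -> ('rV[R]_n -> R) -> R)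
    (htime : exists K : R, \forall N \near \oo,
       forall (X : {fset 'rV[R]_n}) (g : 'rV[R]_n -> R),
         [set` X] `<=` Omega -> #|` X| = N -> nn_interpolant Omega X f g ->
         `|time X g| <= K * N%:R `^ a) :
  exists (fstar : R) (tau : R)
         (chi : R -> {fset 'rV[R]_n}) (I : R -> 'rV[R]_n -> R),
    let N := fun eps : R => #|` chi eps| in
    [/\ is_min [set f x | x in Omega] fstar,
        0 < tau,
        (forall eps : R, 0 < eps ->
           [/\ [set` chi eps] `<=` Omega,
               quasi_uniform tau Omega (chi eps),
               nn_interpolant Omega (chi eps) f (I eps) &
               exists m : R, is_min [set I eps x | x in Omega] m /\
                             `|m - fstar| < eps]),
        (fun eps => fill_distance Omega (chi eps))
          =O_ (0^'+) (fun eps => (N eps)%:R `^ ((gamma - 1) / n%:R)) &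
        (fun eps => time (chi eps) (I eps))
          =O_ (0^'+) (fun eps => (N eps)%:R `^ a)
        /\
        (fun eps => (N eps)%:R `^ a)
          =O_ (0^'+) (fun eps =>
            2 `^ (n%:R * a / (alpha * (1 - gamma)) * logb 2^-1 eps))].
Proof.
have /andP[al0 _] := halpha; have /andP[g0 g1] := hgamma.
have [fstar fstarP] := holder_min hC al0 hOmega hdiam hf.
have [d d0 line] := packing_line hn hOmega.
have cO : connected Omega.
  by have [U [_ cU _ ->]] := hOmega; exact: connected_closure.
have [p Op] : Omega !=set0.
  by have [U [_ _ [p Up] ->]] := hOmega; exists p; exact: subset_closure.
have [K htimeK] := htime.
(* The cap 1 is what [packing_card] requires; the cap [d / 2] makes a two-point packing available
   for every [eps], hence at least two samples. *)
pose r0 : R := Num.min 1 (d / 2).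
pose rho (eps : R) := (eps / C) `^ alpha^-1.
pose r eps := Num.min r0 (rho eps).
have r00 : 0 < r0 by rewrite lt_min ltr01 divr_gt0.
have rho0 eps : 0 < eps -> 0 < rho eps by move=> e0; rewrite powR_gt0// divr_gt0.
have rho_le eps s : 0 < s -> eps < C * s `^ alpha -> 0 < eps -> rho eps <= s.
  move=> s0 eps_s e0; have -> : s = (s `^ alpha) `^ alpha^-1.
    by rewrite -powRrM divff ?gt_eqF// powRr1 ?ltW.
  rewrite ge0_ler_powR ?nnegrE ?invr_ge0 ?powR_ge0 ?divr_ge0 ?(ltW al0) ?(ltW e0) ?(ltW hC)//.
  by rewrite ler_pdivrMr// mulrC ltW.
have r01 eps : 0 < eps -> 0 < r eps <= 1.
  by move=> e0; rewrite lt_min r00 rho0//= !ge_min lexx.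
(* The sample set and interpolant are chosen together; nonpositive [eps] receives a dummy pair. *)
have /choice[P PP] : forall eps, exists P : {fset 'rV[R]_n} * ('rV[R]_n -> R),
    0 < eps -> max_packing (r eps) Omega P.1 /\ nn_interpolant Omega P.1 f P.2.
  move=> eps; have [e0|e0] := ltP 0 eps; last by exists (fset0, f).
  have [X Xmax] := max_packing_exists (r01 _ e0) hdiam.
  have /andP[re0 _] := r01 _ e0.
  have [x xX _] := max_packing_cover re0 Xmax Op.
  by have [g gP] := nn_interpolant_exists Omega f xX; exists (X, g).
have large eps M : 0 < eps -> (0 < M)%N -> r eps <= d / M%:R -> (M <= #|` (P eps).1|)%N.
  move=> e0 M0 rM; have [X Xp <-] := line _ M0.
  by have [[_ Pmax] _] := PP _ e0; apply: Pmax; exact: packing_le Xp.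
have two eps : 0 < eps -> (1 < #|` (P eps).1|)%N.
  by move=> e0; apply: large => //; rewrite !ge_min lexx orbT.
pose c : R := 2 * n%:R + 3.
have c0 : 0 < c by rewrite ltr_wpDl// mulr_ge0.
have card_le eps : 0 < eps -> #|` (P eps).1|%:R <= (c / r eps) ^+ n.
  by move=> e0; have [[Xp _] _] := PP _ e0; exact: packing_card (r01 _ e0) hdiam Xp.
exists fstar, 2, (fun eps => (P eps).1), (fun eps => (P eps).2) => N; split => //.
- move=> eps e0; have [Xmax gP] := PP _ e0; have /andP[re0 _] := r01 _ e0.
  split => //; first by have [[]] := Xmax.
    exact: max_packing_quasi_uniform re0 cO Xmax (two _ e0).
  have [m [mP mf]] := nn_interpolant_min hC (ltW al0) re0 hf fstarP Xmax gP.
  exists m; split => //; apply: lt_le_trans mf _.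
  rewrite -[leRHS](powR_root_scaled hC al0 e0) ler_pM2l// ge0_ler_powR ?(ltW al0) ?nnegrE ?(ltW re0) ?(ltW (rho0 _ e0))//.
  by rewrite ge_min lexx orbT.
- apply/eqO_exP; exists c => //; near=> eps.
  have e0 : 0 < eps by near: eps; exact: nbhs_right_gt.
  have [Xmax gP] := PP _ e0; have /andP[re0 _] := r01 _ e0.
  have N0 : (0 < N eps)%N by exact: ltnW (two _ e0).
  rewrite !ger0_norm ?powR_ge0//; last first.
    by apply: fill_distance_ge0; rewrite -cardfs_gt0.
  apply: le_trans (packing_fill_rate hn N0 re0 c0 g0 (card_le _ e0)).
  by apply: max_packing_fill_distance => //; exists p.
- split; apply/eqO_exP.
    (* The big-O constant must be positive, whereas [K] has arbitrary sign. *)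
    exists (`|K| + 1); first by rewrite ltr_wpDl.
    have [M _ MP] := htimeK; near=> eps.
    have e0 : 0 < eps by near: eps; exact: nbhs_right_gt.
    have [[[XO _] _] gP] := PP _ e0.
    rewrite [X in _ * X]ger0_norm ?powR_ge0//.
    apply: (@le_trans _ _ (K * (N eps)%:R `^ a)).
      (* The cost assumption holds only from size [M] on, which is reached once [r eps] is at most
         [d / M.+1]; the successor avoids division by zero. *)
      apply: MP gP => //=; apply: leq_trans (leqnSn M) _; apply: large => //.
      have dM : 0 < d / M.+1%:R by rewrite divr_gt0.
      rewrite ge_min rho_le ?orbT//; near: eps.
      by apply: nbhs_right_lt; rewrite mulr_gt0// powR_gt0 // divr_gt0.
    apply: ler_wpM2r; first exact: powR_ge0.
    by apply: le_trans (ler_norm K) _; rewrite lerDl.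
  exists (c `^ (n%:R * a) * C^-1 `^ (- (n%:R * a / alpha))).
    by rewrite mulr_gt0 ?powR_gt0 ?invr_gt0.
  near=> eps.
  have e0 : 0 < eps by near: eps; exact: nbhs_right_gt.
  rewrite !ger0_norm ?powR_ge0// powR2_logb2V//.
  apply: packing_cost_rate (card_le _ e0) => //; first exact: ltW.
    by rewrite e0 /=; near: eps; exact: nbhs_right_ltW.
  (* Close to 0 the cap [r0] is inactive, so the radius is exactly [rho eps]. *)
  rewrite /r min_r//; apply: rho_le => //; near: eps.
  by apply: nbhs_right_lt; rewrite mulr_gt0 // powR_gt0.
Unshelve. all: by end_near.
Qed.
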